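(* Let $G$ be a group. The following are equivalent: (1) For every $E \subseteq G$ and every finite $A \subseteq G$, there is a $\mu \in P(G)$ such that $\mu(gE) = \mu(E)$ for all $g \in A$. (2) For every finite $A \subseteq G$, there is a finite $B \subseteq G$ which is $\frac{1}{2}$-Ramsey with respect to $A$. (3) For every finite $A \subseteq G$, there is a finite $B \subseteq G$ which is $0$-Ramsey with respect to $A$. (4) $G$ is amenable.
   Context: $G$ is a discrete group. For a set $A$, $P(A)$ denotes the collection of all finitely additive probability measures defined on all subsets of $A$. If $A \subseteq G$, a measure in $P(A)$ is identified with the measure on $G$ concentrated on $A$ (so $\mu(E)$ means $\mu(E \cap A)$), and thus $P(A) \subseteq P(G)$. $G$ is amenable if there is a $\mu \in P(G)$ with $\mu(gE) = \mu(E)$ for all $g \in G$ and all $E \subseteq G$. Here $gE = \{gx : x \in E\}$. The group operation is extended bilinearly to $\ell^1(G)$ by $\mu\nu(E) = \sum_{xy \in E} \mu(\{x\})\nu(\{y\})$ (sum over pairs $(x,y)$ with $xy \in E$); elements of $G$ are identified with point masses, so $g\nu(E) = \nu(g^{-1}E)$. For finite $A \subseteq G$ and finitely supported $\nu$, $P(A)\nu = \{\mu\nu : \mu \in P(A)\}$. If $A$ and $B$ are finite subsets of $G$ and $\epsilon \geq 0$, then $B$ is $\epsilon$-Ramsey with respect to $A$ if for every $E \subseteq B$ there is a $\nu \in P(B)$ such that $P(A)\nu \subseteq P(B)$ and $|\mu\nu(E) - \mu'\nu(E)| \leq \epsilon$ for all $\mu, \mu' \in P(A)$. *)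

(* Defs.v *)
From mathcomp Require Import all_boot all_order all_algebra.
From mathcomp Require Import boolp classical_sets functions cardinality fsbigop.
From mathcomp Require Import reals.

Set Implicit Arguments.
Unset Strict Implicit.
Unset Printing Implicit Defensive.

Import Order.TTheory GRing.Theory Num.Theory.

Local Open Scope classical_set_scope.
Local Open Scope ring_scope.

(* Written with explicit real-valued set functions rather than with
   [{content set T -> \bar R}], which would need a structure on T making every
   subset measurable. *)
Definition finitely_additive_probability (R : realType) (T : Type)
    (mu : set T -> R) : Prop :=
  [/\ forall E, 0 <= mu E,
      mu setT = 1 &
      forall E F, E `&` F = set0 -> mu (E `|` F) = mu E + mu F].

(* P(A), for A a subset of T, viewed inside P(T) = fap_on setT: the measures that are
   concentrated on A. *)
Definition fap_on (R : realType) (T : Type) (A : set T) : set (set T -> R) :=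
  [set mu | finitely_additive_probability mu /\
            forall E, mu E = mu (E `&` A)].

Definition translate (G : groupType) (g : G) (E : set G) : set G :=
  [set (g * x)%g | x in E].

Definition amenable (R : realType) (G : groupType) : Prop :=
  exists2 mu : set G -> R, fap_on setT mu &
    forall (g : G) (E : set G), mu (translate g E) = mu E.

(* The product of l^1(G).  The sum is a finitely supported one (it is 0 by
   convention if infinitely many terms are nonzero); the Ramsey property below
   only multiplies measures concentrated on finite sets. *)
Definition conv (R : realType) (G : groupType) (mu nu : set G -> R) :
    set G -> R :=
  fun E => \sum_(p \in [set p : G * G | E (p.1 * p.2)%g])
             (mu [set p.1] * nu [set p.2]).

(* B is eps-Ramsey with respect to A.  Meant for finite A and B and eps >= 0. *)
Definition Ramsey_wrt (R : realType) (G : groupType) (eps : R)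
    (B A : set G) : Prop :=
  forall E : set G, E `<=` B ->
    exists2 nu : set G -> R, fap_on B nu &
      [set conv mu nu | mu in fap_on A] `<=` fap_on B /\
      forall mu mu' : set G -> R, fap_on A mu -> fap_on A mu' ->
        `|conv mu nu E - conv mu' nu E| <= eps.

(* Main.v *)
(* Half-Ramsey sets yield 3/4-Ramsey behaviour for functions with values in an
   interval, by thresholding at the midpoint.  For functions, contraction
   constants multiply: if B is d-Ramsey with respect to A via s, and C is
   e-Ramsey with respect to B via t, then the product s t contracts by d e.  So
   every positive constant is reached, and the same chaining handles finitely
   many functions at once; an ultralimit then gives an invariant measure.
   Conversely, suppose each finite B has a bad set E_B witnessing that it is not
   0-Ramsey with respect to A, and let E be an ultralimit of the E_B.  A measure
   mu with mu (g^-1 E) = mu E on A agrees on the finitely many sets g^-1 E with a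
   finitely supported measure, and some large B whose E_B matches E on the
   relevant finite set is then Ramsey for E_B, a contradiction. *)
Require Import Defs.
From mathcomp Require Import all_boot all_order all_algebra.
From mathcomp Require Import boolp classical_sets functions cardinality fsbigop.
From mathcomp Require Import reals.
From mathcomp Require Import finmap filter lra.

Import Order.TTheory GRing.Theory Num.Theory.

Local Open Scope classical_set_scope.
Local Open Scope ring_scope.

Set Implicit Arguments.
Unset Strict Implicit.

(** * Indicator functions and finitely supported measures *)

Definition ind {R : realType} {T : Type} (E : set T) (x : T) : R := `[< E x >]%:R.

Lemma ind_ge0 {R : realType} {T : Type} (E : set T) (x : T) : 0 <= ind E x :> R.
Proof. exact: ler0n. Qed.

Lemma ind_le1 {R : realType} {T : Type} (E : set T) (x : T) : ind E x <= 1 :> R.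
Proof. by rewrite /ind; case: asboolP. Qed.

Lemma ind_in {R : realType} {T : Type} (E : set T) (x : T) : E x -> ind E x = 1 :> R.
Proof. by move=> Ex; rewrite /ind asboolT. Qed.

Lemma ind_out {R : realType} {T : Type} (E : set T) (x : T) : ~ E x -> ind E x = 0 :> R.
Proof. by move=> Ex; rewrite /ind asboolF. Qed.

Lemma indU {R : realType} {T : Type} (E F : set T) (x : T) : E `&` F = set0 ->
  ind (E `|` F) x = ind E x + ind F x :> R.
Proof.
move=> EF0; have [Ex|nEx] := pselect (E x).
  have nFx : ~ F x by move=> Fx; have : (E `&` F) x by []; rewrite EF0.
  by rewrite (ind_in Ex) (ind_out nFx) addr0 ind_in//; left.
have [Fx|nFx] := pselect (F x).
  by rewrite (ind_in Fx) (ind_out nEx) add0r ind_in//; right.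
by rewrite !ind_out ?addr0// => -[].
Qed.

(* A finite list of weighted points stands for a finitely supported signed
   measure; points may repeat. *)
Definition integral {R : realType} {T : Type} (s : seq (R * T)) (f : T -> R) : R :=
  \sum_(p <- s) p.1 * f p.2.

Definition prob {R : realType} {T : eqType} (s : seq (R * T)) : Prop :=
  (forall p, p \in s -> 0 <= p.1) /\ \sum_(p <- s) p.1 = 1.

Section Integral.
Context {R : realType} {T : choiceType}.
Implicit Types (s : seq (R * T)) (f g : T -> R) (E F : set T).

Lemma eq_integral s f g : (forall p, p \in s -> f p.2 = g p.2) ->
  integral s f = integral s g.
Proof. by move=> fg; apply: eq_big_seq => p /fg ->. Qed.

Lemma integralD s f g : integral s (fun x => f x + g x) = integral s f + integral s g.
Proof. by rewrite /integral -big_split; apply: eq_bigr => p _; rewrite mulrDr. Qed.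

Lemma integralZ s (a : R) f : integral s (fun x => a * f x) = a * integral s f.
Proof. by rewrite /integral mulr_sumr; apply: eq_bigr => p _; rewrite mulrCA. Qed.

Lemma integral_cst s (a : R) : prob s -> integral s (fun=> a) = a.
Proof. by case=> _ s1; rewrite /integral -mulr_suml s1 mul1r. Qed.

Lemma le_integral s f g : prob s -> (forall p, p \in s -> f p.2 <= g p.2) ->
  integral s f <= integral s g.
Proof.
case=> s0 _ fg; rewrite /integral big_seq [leRHS]big_seq.
by apply: ler_sum => p ps; rewrite ler_wpM2l ?s0 ?fg.
Qed.

Lemma integral_between s f (a b : R) : prob s ->
  (forall p, p \in s -> a <= f p.2 <= b) -> a <= integral s f <= b.
Proof.
move=> sp fab; rewrite -{1}(integral_cst a sp) -{1}(integral_cst b sp).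
by apply/andP; split; apply: le_integral => // p /fab /andP[].
Qed.

(** * Finitely additive probabilities and their point masses *)

Lemma fap_integral s : prob s ->
  finitely_additive_probability (fun E => integral s (ind E)).
Proof.
move=> sp; split.
- move=> E; case: sp => s0 _; rewrite /integral big_seq sumr_ge0// => p ps.
  by rewrite mulr_ge0 ?s0 ?ind_ge0.
- rewrite -[RHS](integral_cst 1 sp); apply: eq_integral => p _; exact: ind_in.
- by move=> E F EF0; rewrite -integralD; apply: eq_integral => p _; exact: indU.
Qed.

Lemma fap_on_integral s (A : set T) : prob s -> (forall p, p \in s -> A p.2) ->
  fap_on A (fun E => integral s (ind E)).
Proof.
move=> sp sA; split; first exact: fap_integral.
move=> E; apply: eq_integral => p /sA Ap.
by congr (_%:R); congr nat_of_bool; apply: asbool_equiv_eq; split=> [|[]].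
Qed.

Lemma fap_set0 (mu : set T -> R) : finitely_additive_probability mu -> mu set0 = 0.
Proof.
case=> _ _ muD; have := muD set0 set0 (setI0 _).
by rewrite setU0 => /eqP; rewrite -subr_eq0 opprD addrA subrr add0r oppr_eq0 => /eqP.
Qed.

Lemma fap_setIC (mu : set T -> R) E F : finitely_additive_probability mu ->
  mu E = mu (E `&` F) + mu (E `\` F).
Proof. by case=> _ _ <-; [rewrite setUIDK | rewrite setDE setIACA setICr setI0]. Qed.

Lemma le_fap (mu : set T -> R) E F : finitely_additive_probability mu ->
  E `<=` F -> mu E <= mu F.
Proof.
move=> mup EF; rewrite (fap_setIC F E mup) setIidr// lerDl.
by case: mup.
Qed.

Lemma fap_le1 (mu : set T -> R) E : finitely_additive_probability mu -> mu E <= 1.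
Proof. by move=> mup; case: (mup) => _ <- _; exact: le_fap. Qed.

Lemma fap_seq (mu : set T -> R) (r : seq T) E : finitely_additive_probability mu ->
  uniq r -> mu (E `&` [set` r]) = \sum_(x <- r) mu [set x] * ind E x.
Proof.
move=> mup; elim: r => [_|x r IH /= /andP[xr ur]].
  by rewrite big_nil set_nil setI0 fap_set0.
rewrite big_cons -IH// (fap_setIC _ [set x] mup); congr (_ + _).
  have [Ex|nEx] := pselect (E x).
    rewrite ind_in// mulr1; congr mu; apply/seteqP; split=> [y []//|y ->].
    by split=> //; split=> //=; rewrite inE eqxx.
  rewrite ind_out// mulr0 (_ : _ `&` _ = set0) ?fap_set0//.
  by apply/seteqP; split=> [y [[Ey _] yx]|//]; apply: nEx; rewrite -yx.
congr mu; apply/seteqP; split=> [y [[Ey]]/=|y [Ey /= yr]].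
  by rewrite inE => /orP[/eqP ->//|yr _].
split; first by split=> //=; rewrite inE yr orbT.
by move=> yx; move: xr; rewrite -yx yr.
Qed.

Lemma fap_on_finite (mu : set T -> R) (A E : set T) : finite_set A -> fap_on A mu ->
  mu E = \sum_(x <- fset_set A) mu [set x] * ind E x.
Proof.
by move=> fA [mup muA]; rewrite -fap_seq// fset_setK.
Qed.

Lemma fap_on_weights (mu : set T -> R) (A : set T) : finite_set A -> fap_on A mu ->
  \sum_(x <- fset_set A) mu [set x] = 1.
Proof.
move=> fA muA; case: (muA) => -[_ <- _] _.
by rewrite (fap_on_finite setT fA muA); apply: eq_bigr => x _; rewrite ind_in// mulr1.
Qed.

(** Points of mass zero are dropped: [Ramsey_wrt_point] can only confine the translates of points
    that carry mass. *)
Definition atoms (mu : set T -> R) (A : set T) : seq (R * T) :=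
  [seq (mu [set x], x) | x <- fset_set A & mu [set x] != 0].

Lemma integral_atoms (mu : set T -> R) (A : set T) f :
  integral (atoms mu A) f = \sum_(x <- fset_set A) mu [set x] * f x.
Proof.
rewrite /integral big_map big_filter [RHS](bigID (fun x => mu [set x] != 0))/=.
rewrite [X in _ = _ + X]big1 ?addr0// => x /negbNE/eqP ->; exact: mul0r.
Qed.

Lemma prob_atoms (mu : set T -> R) (A : set T) : finite_set A -> fap_on A mu ->
  prob (atoms mu A).
Proof.
move=> fA muA; split; first by case: muA => -[mu0 _ _] _ p /mapP[x _ ->]/=.
rewrite -(fap_on_weights fA muA); under [RHS]eq_bigr do rewrite -[mu _]mulr1.
by rewrite -(integral_atoms mu A (fun=> 1)); apply: eq_bigr => p _; rewrite mulr1.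
Qed.

(* Splitting X along the sets of l one at a time keeps one point per atom. *)
Lemma finite_discretization (mu : set T -> R) (l : seq (set T)) (X : set T) :
  finitely_additive_probability mu ->
  exists s, [/\ forall p, p \in s -> 0 <= p.1 /\ X p.2,
     \sum_(p <- s) p.1 = mu X &
     forall E, E \in l -> integral s (ind E) = mu (E `&` X)].
Proof.
move=> mup; elim: l X => [|S l IH] X.
  (* No point can be picked in an empty cell, but its mass is 0, so the empty list serves. *)
  have [->|/set0P[x Xx]] := eqVneq X set0.
    by exists [::]; rewrite big_nil fap_set0.
  exists [:: (mu X, x)]; split=> //; last by rewrite big_seq1.
  by move=> p; rewrite inE => /eqP -> /=; split=> //; case: mup.
have [s1 [s1X s1t s1l]] := IH (X `&` S).
have [s2 [s2X s2t s2l]] := IH (X `\` S).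
exists (s1 ++ s2); split.
- by move=> p; rewrite mem_cat => /orP[/s1X|/s2X] [p0 []].
- by rewrite big_cat/= s1t s2t -fap_setIC.
- move=> E; rewrite inE => lE; rewrite /integral big_cat/= -!/(integral _ _).
  (* For [S] itself, all of [s1] lies inside and all of [s2] outside; for the other sets, additivity
     over the two cells suffices. *)
  case/orP: lE => [/eqP ->|lE].
    rewrite setIC -s1t [X in _ + X]big_seq big1 ?addr0.
      by apply: eq_big_seq => p /s1X[_ [_ Sp]]; rewrite ind_in// mulr1.
    by move=> p /s2X[_ [_ Sp]]; rewrite ind_out// mulr0.
  by rewrite s1l// s2l// (fap_setIC (E `&` X) S mup) setIA setIDA.
Qed.

End Integral.

(** * Products of measures concentrated on finite sets *)

Section Conv.
Context {R : realType} {G : groupType}.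
Implicit Types (mu nu : set G -> R) (A B E : set G).

(** Point masses vanish off [A] and off [B], so the sum over pairs lives on a finite rectangle and
    its default value for infinite support never arises. *)
Lemma conv_fap_on mu nu A B E : finite_set A -> finite_set B ->
  fap_on A mu -> fap_on B nu ->
  conv mu nu E = \sum_(x <- fset_set A) mu [set x] * nu [set y | E (x * y)%g].
Proof.
move=> fA fB muA nuB.
have out C (m : set G -> R) x : fap_on C m -> ~ C x -> m [set x] = 0.
  case=> mp mC nCx; rewrite mC (_ : _ `&` _ = set0) ?fap_set0//.
  by apply/seteqP; split=> [y [-> //]|].
pose F (p : G * G) := mu [set p.1] * (nu [set p.2] * ind E (p.1 * p.2)%g).
transitivity (\sum_(p \in A `*` B) F p).
  rewrite /conv; transitivity (\sum_(p \in setT) F p).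
    rewrite fsbig_mkcond; apply: eq_fsbigr => p _; rewrite /patch /F.
    have [Ep|nEp] := pselect (E (p.1 * p.2)%g).
      by rewrite mem_set// ind_in// mulr1.
    by rewrite memNset// ind_out// !mulr0.
  apply/esym/fsbig_widen => // -[x y] [_ /=] /not_andP[nA|nB].
    by rewrite /F /= (out _ _ _ muA nA) mul0r.
  by rewrite /F /= (out _ _ _ nuB nB) mul0r mulr0.
rewrite -(pair_fsbig _ (fun x y => F (x, y)))// fsbig_finite//.
apply: eq_bigr => x _; rewrite (fap_on_finite _ fB nuB) mulr_sumr fsbig_finite//.
Qed.

Lemma conv_point (g : G) nu B E : finite_set B -> fap_on B nu ->
  conv (fun S => integral [:: (1, g)] (ind S)) nu E = nu [set y | E (g * y)%g].
Proof.
move=> fB nuB.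
have pg : prob [:: (1 : R, g)].
  by split=> [p|]; rewrite ?big_seq1// inE => /eqP ->.
have mug : fap_on [set g] (fun S : set G => integral [:: (1 : R, g)] (ind S)).
  by apply: fap_on_integral => // p; rewrite inE => /eqP ->.
rewrite (conv_fap_on _ _ fB mug nuB)// fset_set1 big_seq_fset1.
by rewrite /integral big_seq1/= ind_in// !mul1r.
Qed.

End Conv.

(** * Limits along an ultrafilter *)

Section Ultralimit.
Context {R : realType} {I : Type} (U : set_system I) {FU : UltraFilter U}.
Implicit Types (u : I -> R) (e l : R).

(* The limit of u along U, when u is bounded U-almost everywhere. *)
Definition ultralimit u : R := sup [set t | U [set i | t <= u i]].

Lemma near_ultralimit u e : U [set i | 0 <= u i <= 1] -> 0 < e ->
  U [set i | `|u i - ultralimit u| <= e].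
Proof.
move=> u01 e0; set S := [set t | U [set i | t <= u i]].
have S1 : ubound S 1.
  move=> t St; have [i [/= tu /andP[_ u1]]] := filter_ex (filterI St u01).
  exact: le_trans u1.
have hS : has_sup S.
  by split; [exists 0; apply: filterS u01 => i /andP[] | exists 1].
have below : U [set i | ultralimit u - e <= u i].
  have [t St lt] := sup_adherent e0 hS.
  by apply: filterS St => i /= tu; apply: le_trans tu; exact: ltW.
have above : U [set i | u i <= ultralimit u + e].
  (* Otherwise the complement lies in [U], which puts [ultralimit u + e] into the set [S] whose
     supremum is [ultralimit u]. *)
  have [//|nU] := in_ultra_setVsetC [set i | u i <= ultralimit u + e] FU.
  have : S (ultralimit u + e).
    by apply: filterS nU => i /= /negP; rewrite -ltNge => /ltW.
  by move=> /(ub_le_sup hS.2); rewrite -/(ultralimit u) gerDl leNgt e0.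
apply: filterS2 below above => i /= h1 h2; rewrite ler_norml; lra.
Qed.

Lemma ultralimit_unique u l : U [set i | 0 <= u i <= 1] ->
  (forall e, 0 < e -> U [set i | `|u i - l| <= e]) -> ultralimit u = l.
Proof.
move=> u01 ul; apply/eqP; rewrite -subr_eq0 -normr_le0; apply/ler_addgt0Pr => e e0.
have e2 : 0 < e / 2 by rewrite divr_gt0.
have [i [/= h1 h2]] := filter_ex (filterI (near_ultralimit u01 e2) (ul _ e2)).
rewrite add0r (_ : _ - _ = (u i - l) - (u i - ultralimit u)); last by lra.
by rewrite (le_trans (ler_normB _ _))// [leRHS](splitr e) lerD.
Qed.

End Ultralimit.

(** * Invariant measures yield 0-Ramsey sets *)

Section Amenability.
Context {R : realType} {G : groupType}.
Implicit Types (A B E : set G) (s : seq (R * G)) (f : G -> R).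

Lemma translateE (g : G) E : translate g E = [set y | E (g^-1 * y)%g].
Proof.
apply/seteqP; split=> [_ [x Ex <-]|y Ey] /=; first by rewrite mulKg.
by exists (g^-1 * y)%g; rewrite ?mulVKg.
Qed.

Lemma ind_translate (g : G) E (x : G) :
  ind (translate g E) x = ind E (g^-1 * x)%g :> R.
Proof. by rewrite translateE. Qed.

(** A measure in P(A) is a convex combination of point masses, so its product with nu gives [E] a
    weighted average of the values nu(g^-1 E) with g in [A], all equal to [c]. *)
Lemma Ramsey_witness (A B E : set G) (c : R) s : finite_set A -> finite_set B ->
  prob s -> (forall p, p \in s -> B p.2) ->
  (forall g p, A g -> p \in s -> B (g * p.2)%g) ->
  (forall g, A g -> integral s (fun y => ind E (g * y)%g) = c) ->
  exists2 nu : set G -> R, fap_on B nu &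
      [set conv mu nu | mu in fap_on A] `<=` fap_on B /\
      forall mu mu' : set G -> R, fap_on A mu -> fap_on A mu' ->
        `|conv mu nu E - conv mu' nu E| <= 0.
Proof.
move=> fA fB sp sB AsB sc.
have nuB := fap_on_integral sp sB; set nu := (X in fap_on B X) in nuB.
have AP x : x \in fset_set A -> A x by rewrite in_fset_set// => /set_mem.
exists nu => //; split.
  move=> _ [mu muA <-].
  have convE S : conv mu nu S =
      \sum_(x <- fset_set A) mu [set x] * nu [set y | S (x * y)%g].
    exact: conv_fap_on fA fB muA nuB.
  have [[nu0 nuT nuD] _] := nuB; have [[mu0 _ _] _] := muA.
  split; first split.
  - by move=> S; rewrite convE sumr_ge0// => x _; rewrite mulr_ge0.
  - rewrite convE -[RHS](fap_on_weights fA muA); apply: eq_bigr => x _.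
    by rewrite (_ : [set y | _] = setT) ?nuT ?mulr1//; apply/seteqP.
  - move=> S S' SS'; rewrite !convE -big_split; apply: eq_bigr => x _ /=.
    rewrite -mulrDr -nuD//; apply/seteqP; split=> [y /= xyS|//].
    by have : (S `&` S') (x * y)%g by []; rewrite SS'.
  - move=> S; rewrite !convE; apply: eq_big_seq => x /AP Ax; congr (_ * _).
    apply: eq_integral => p /(AsB _ _ Ax) Bp.
    by congr (_%:R); congr nat_of_bool; apply: asbool_equiv_eq; split=> [|[]].
have conv_c mu : fap_on A mu -> conv mu nu E = c.
  move=> muA; rewrite (conv_fap_on _ fA fB muA nuB) -[RHS]mul1r.
  rewrite -(fap_on_weights fA muA) mulr_suml; apply: eq_big_seq => x /AP Ax.
  by rewrite -(sc _ Ax).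
by move=> mu mu' muA mu'A; rewrite !conv_c// subrr normr0.
Qed.

Lemma Ramsey0_of_invariant_measures :
  (forall (E A : set G), finite_set A ->
     exists2 mu : set G -> R, fap_on setT mu &
       forall g : G, A g -> mu (translate g E) = mu E) ->
  forall A : set G, finite_set A ->
    exists2 B : set G, finite_set B & Ramsey_wrt (0 : R) B A.
Proof.
move=> inv A fA; apply: contrapT => noB.
pose good B E := exists2 nu : set G -> R, fap_on B nu &
      [set conv mu nu | mu in fap_on A] `<=` fap_on B /\
      forall mu mu' : set G -> R, fap_on A mu -> fap_on A mu' ->
        `|conv mu nu E - conv mu' nu E| <= 0.
(* Finiteness is a premise inside the existential, so that [bad] is defined on all sets, with
   arbitrary values on infinite ones. *)
have /choice[bad badP] : forall B, exists E, finite_set B -> ~ good B E.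
  move=> B; apply: contrapT => nE; apply: noB; exists B.
    by apply: contrapT => nfB; apply: nE; exists set0.
  by move=> E _; apply: contrapT => nEB; apply: nE; exists E.
(* The basic sets are the tails of the net C -> [bad C] over finite sets ordered by inclusion. *)
pose F := filter_from [set B : set G | finite_set B]
  (fun B => [set bad C | C in [set C | finite_set C /\ B `<=` C]]).
have FF : ProperFilter F.
  apply: filter_from_proper; last first.
    by move=> B fB; exists (bad B); exists B => //; split.
  apply: filter_from_filter; first by exists set0; exact: finite_set0.
  move=> B C fB fC; exists (B `|` C); first by rewrite /= finite_setU.
  by move=> S [D [fD]]; rewrite subUset => -[BD CD] <-; split; exists D.
have [U [UU FU]] := ultraFilterLemma FF.
pose E := [set x | U [set S : set G | S x]].
(* The limit set [E] is pointwise, so agreement with it holds on finitely many points at a time. *)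
have Uagree (r : seq G) : U [set S | forall x, x \in r -> (S x <-> E x)].
  elim: r => [|x r IH]; first by apply: filterS filterT => S _ x; rewrite in_nil.
  have Ux : U [set S | S x <-> E x].
    have [Ux|Ux] := in_ultra_setVsetC [set S : set G | S x] UU.
      by have Ex : E x := Ux; apply: filterS Ux => S /= Sx; split.
    have nEx : ~ E x by move=> Ex; have [S []] := filter_ex (filterI Ex Ux).
    by apply: filterS Ux => S /= nSx; split.
  apply: filterS2 Ux IH => S /= Sx Sr y.
  by rewrite inE => /orP[/eqP ->|/Sr].
(* Inverses appear because integrating y -> [ind E (g * y)] measures the translate of [E] by
   g^-1. *)
have [mu [mup _] muE] := inv E _ (finite_image (fun g => g^-1)%g fA).
have [s [s0 s1 sE]] := finite_discretization
  [seq translate g^-1%g E | g <- fset_set A] setT mup.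
have sp : prob s by split=> [p /s0[]//|]; rewrite s1; case: mup.
(* A finite set containing [r] contains the support of [s] and its translates by [A], and agreement
   with [E] on [r] determines every integral involved. *)
pose r := [seq p.2 | p <- s] ++ [seq (g * p.2)%g | g <- fset_set A, p <- s].
have Ar g p : A g -> p \in s -> (g * p.2)%g \in r.
  move=> Ag ps; rewrite mem_cat; apply/orP; right; apply/allpairsP.
  by exists (g, p); split=> //=; rewrite in_fset_set// mem_set.
have UB : U [set bad C | C in [set C | finite_set C /\ [set` r] `<=` C]].
  by apply: FU; exists [set` r] => //; exact: finite_seq.
have [S [agree [C [fC rC] badC]]] := filter_ex (filterI (Uagree r) UB).
apply: (badP C fC); apply: (@Ramsey_witness _ _ _ (mu E) s) => //.
- by move=> p ps; apply: rC; rewrite /= mem_cat map_f.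
- by move=> g p Ag ps; apply: rC; exact: Ar.
move=> g Ag; rewrite -(muE g^-1%g); last by exists g.
rewrite -[X in mu X]setIT -sE; last by apply/mapP; exists g; rewrite ?in_fset_set ?mem_set.
apply: eq_integral => p ps; rewrite ind_translate invgK.
congr (_%:R); congr nat_of_bool; apply: asbool_equiv_eq; rewrite badC.
by apply: agree; exact: Ar.
Qed.

(** * Contraction for functions with values in an interval *)

(* The values are confined to an interval [c, c + eps r], rather than being
   pairwise close, so that the conclusion can be fed back as the hypothesis on f. *)
Definition Ramsey_function (eps : R) (B A : set G) : Prop :=
  forall (f : G -> R) (a r : R), 0 <= r -> (forall x, B x -> a <= f x <= a + r) ->
  exists2 s, prob s & (forall g p, A g -> p \in s -> B (g * p.2)%g) /\
    exists c, forall g, A g ->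
      c <= integral s (fun x => f (g * x)%g) <= c + eps * r.

(** The infimum of the values serves as left endpoint; this turns the pairwise bound of [Ramsey_wrt]
    into the interval form of [Ramsey_function]. *)
Lemma interval_of_pairwise (A : set G) (h : G -> R) (e : R) :
  (forall x y, A x -> A y -> `|h x - h y| <= e) ->
  exists c, forall x, A x -> c <= h x <= c + e.
Proof.
move=> he; have [->|/set0P[x0 Ax0]] := eqVneq A set0; first by exists 0.
exists (inf (h @` A)) => x Ax; apply/andP; split.
  apply: ge_inf; last by exists x.
  exists (h x0 - e) => _ [y Ay <-].
  by have := he _ _ Ax0 Ay; rewrite ler_norml => /andP[_]; lra.
rewrite -lerBlDr; apply: lb_le_inf; first by exists (h x), x.
by move=> _ [y Ay <-]; have := he _ _ Ax Ay; rewrite ler_norml => /andP[_]; lra.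
Qed.

(** Testing the Ramsey condition on the point masses at elements of [A] replaces measures by group
    elements. *)
Lemma Ramsey_wrt_point (eps : R) (B A E : set G) : finite_set B ->
  Ramsey_wrt eps B A -> E `<=` B ->
  exists2 s, prob s & (forall g p, A g -> p \in s -> B (g * p.2)%g) /\
    exists c, forall g, A g ->
      c <= integral s (fun x => ind E (g * x)%g) <= c + eps.
Proof.
move=> fB RB EB; have [nu nuB [AB nuE]] := RB E EB.
have [[nu0 _ _] _] := nuB.
pose d (g : G) S := integral [:: (1 : R, g)] (ind S).
have dA g : A g -> fap_on A (d g).
  move=> Ag; apply: fap_on_integral => [|p]; last by rewrite inE => /eqP ->.
  by split=> [p|]; rewrite ?big_seq1// inE => /eqP ->.
exists (atoms nu B); first exact: prob_atoms.
split.
  move=> g p Ag /mapP[x]; rewrite mem_filter => /andP[nux _] -> /=.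
  apply: contrapT => nB; move/negP: nux; apply.
  have [cp cB] : fap_on B (conv (d g) nu) by apply: AB; exists (d g) => //; exact: dA.
  (* The translate of nu by [g] gives the complement of [B] mass 0, so a point that [g] moves out of
     [B] has nu-mass 0 and is not among the atoms. *)
  have := cB (~` B); rewrite setICl fap_set0// (conv_point _ _ fB nuB) => nu_out.
  rewrite eq_le nu0 andbT -nu_out; apply: le_fap; first by case: nuB.
  by move=> _ ->.
apply: interval_of_pairwise => g g' Ag Ag'.
have := nuE _ _ (dA _ Ag) (dA _ Ag'); rewrite !(conv_point _ _ fB nuB).
by rewrite !integral_atoms !(fap_on_finite _ fB nuB).
Qed.

(* The set {f >= a + r / 2} determines f up to an error of r / 2. *)
Lemma Ramsey_function_of_half (B A : set G) : finite_set B ->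
  Ramsey_wrt (1 / 2 : R) B A -> Ramsey_function (3 / 4) B A.
Proof.
move=> fB RB f a r r0 fB_ar.
have [|s sp [sB [c sc]]] := Ramsey_wrt_point (E := B `&` [set x | a + r / 2 <= f x]) fB RB.
  exact: subIsetl.
(* The integral of [ind E] varies by at most 1/2, which contributes r/4; with the approximation
   error r/2 this makes 3r/4. *)
exists s => //; split=> //; exists (a + r / 2 * c) => g Ag.
set E := B `&` _ in sc; have /andP[c1 c2] := sc g Ag.
set I := integral s (fun x => ind E (g * x)%g) in c1 c2.
have lo : a + r / 2 * I <= integral s (fun x => f (g * x)%g).
  rewrite -integralZ -{1}(integral_cst a sp) -integralD.
  apply: le_integral => // p ps; have Bp := sB _ _ Ag ps.
  have /andP[f1 f2] := fB_ar _ Bp; have [Ep|nEp] := pselect (E (g * p.2)%g).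
    by rewrite ind_in// mulr1; case: Ep.
  by rewrite ind_out// mulr0 addr0.
have hi : integral s (fun x => f (g * x)%g) <= (a + r / 2) + r / 2 * I.
  rewrite -integralZ -{1}(integral_cst (a + r / 2) sp) -integralD.
  apply: le_integral => // p ps; have Bp := sB _ _ Ag ps.
  have /andP[f1 f2] := fB_ar _ Bp; have [Ep|nEp] := pselect (E (g * p.2)%g).
    by rewrite ind_in// mulr1; lra.
  rewrite ind_out// mulr0 addr0 leNgt; apply/negP => /ltW fh.
  by apply: nEp; split.
have := ler_wpM2l r0 c1; have := ler_wpM2l r0 c2; lra.
Qed.

(** * Chaining contractions by convolution *)

Definition product (s t : seq (R * G)) : seq (R * G) :=
  [seq (p.1 * q.1, (p.2 * q.2)%g) | p <- s, q <- t].

Lemma integral_product s t f :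
  integral (product s t) f = integral s (fun x => integral t (fun y => f (x * y)%g)).
Proof.
rewrite /integral big_allpairs_dep; apply: eq_bigr => p _; rewrite mulr_sumr.
by apply: eq_bigr => q _; rewrite mulrA.
Qed.

Lemma prob_product s t : prob s -> prob t -> prob (product s t).
Proof.
move=> sp tp; split.
  move=> _ /allpairsP[[p q] [/= ps qt ->]] /=.
  by rewrite mulr_ge0//; [case: sp => + _ | case: tp => + _]; apply.
transitivity (integral (product s t) (fun=> 1)).
  by apply: eq_bigr => p _; rewrite mulr1.
by rewrite integral_product !integral_cst.
Qed.

Lemma product_integral_translate (g : G) s t f :
  integral (product s t) (fun x => f (g * x)%g) =
  integral s (fun x => integral t (fun y => f (g * x * y)%g)).
Proof.
rewrite integral_product; apply: eq_bigr => p _; congr (_ * _).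
by apply: eq_bigr => q _; rewrite mulgA.
Qed.

Lemma product_sub (A B C : set G) s t :
  (forall g p, A g -> p \in s -> B (g * p.2)%g) ->
  (forall g p, B g -> p \in t -> C (g * p.2)%g) ->
  forall g p, A g -> p \in product s t -> C (g * p.2)%g.
Proof.
move=> sB tC g _ Ag /allpairsP[[p q] [/= ps qt ->]] /=.
by rewrite mulgA; apply: tC => //; exact: sB.
Qed.

(** Averaging [f] over right translates by [t] gives a function whose values on [B] fill an interval
    of length [e * r] only; [s], chosen for that function, contracts it by [d]. *)
Lemma Ramsey_function_comp (d e : R) (A B C : set G) : 0 <= e ->
  Ramsey_function d B A -> Ramsey_function e C B -> Ramsey_function (d * e) C A.
Proof.
move=> e0 RB RC f a r r0 fC.
have [t tp [tC [b tb]]] := RC f a r r0 fC.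
have [s sp [sB [c sc]]] := RB _ b (e * r) (mulr_ge0 e0 r0) tb.
exists (product s t); first exact: prob_product.
split; first exact: product_sub sB tC.
by exists c => g Ag; rewrite product_integral_translate -mulrA; exact: sc.
Qed.

Lemma Ramsey_function_expr (d : R) : 0 <= d ->
  (forall A, finite_set A -> exists2 B, finite_set B & Ramsey_function d B A) ->
  forall n A, finite_set A ->
    exists2 B, finite_set B & Ramsey_function (d ^+ n) B A.
Proof.
move=> d0 RA; elim=> [|n IH] A fA.
  (* Exponent 0 asks for no contraction: the point mass at the identity keeps the original
     interval. *)
  exists A => // f a r r0 fA_ar; exists [:: (1, 1%g)].
    by split=> [p|]; rewrite ?big_seq1// inE => /eqP ->.
  split=> [g p Ag|]; first by rewrite inE => /eqP ->; rewrite mulg1.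
  exists a => g Ag; rewrite /integral big_seq1/= mulg1 !mul1r; exact: fA_ar.
have [B fB RB] := RA A fA; have [C fC RC] := IH B fB; exists C => //.
by rewrite exprS; apply: Ramsey_function_comp RB RC; exact: exprn_ge0.
Qed.

Lemma expr_three_quarters_small (e : R) : 0 < e -> exists n, (3 / 4 : R) ^+ n <= e.
Proof.
move=> e0.
(* The induction step is 3(n + 4) <= 4(n + 3); the shift by 3 makes it hold from n = 0 on. *)
have bern n : (3 / 4 : R) ^+ n * (n%:R + 3) <= 3.
  elim: n => [|n IH]; first by rewrite expr0; lra.
  apply: le_trans IH; rewrite exprSr -mulrA ler_wpM2l ?exprn_ge0//; first by lra.
  by rewrite -natr1; have : (0 : R) <= n%:R by []; lra.
exists (Num.bound (3 / e)).
have := bern (Num.bound (3 / e)); set n := Num.bound _.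
have : 3 / e < n%:R by apply: archi_boundP; rewrite divr_ge0 ?ltW.
rewrite ltr_pdivrMr// => en /= bn; rewrite leNgt; apply/negP => een.
have n0 : (0 : R) < n%:R + 3 by rewrite ltr_wpDl.
have : e * (n%:R + 3) < (3 / 4) ^+ n * (n%:R + 3) by rewrite ltr_pM2r.
lra.
Qed.

(** The measure [t] treats the first n functions on [B], then [s] treats the last one after
    averaging it by [t]. The earlier intervals survive, since [s] moves [A] into [B] and averages of
    values in an interval stay there. *)
Lemma Ramsey_functions (e : R) : 0 <= e ->
  (forall A, finite_set A -> exists2 B, finite_set B & Ramsey_function e B A) ->
  forall n A, finite_set A -> exists2 B, finite_set B &
    forall f : nat -> G -> R, (forall i x, 0 <= f i x <= 1) ->
    exists2 s, prob s & (forall g p, A g -> p \in s -> B (g * p.2)%g) /\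
      forall i, (i < n)%N -> exists c, forall g, A g ->
        c <= integral s (fun x => f i (g * x)%g) <= c + e.
Proof.
move=> e0 RA; elim=> [|n IH] A fA.
  exists A => // f f01; exists [:: (1, 1%g)].
    by split=> [p|]; rewrite ?big_seq1// inE => /eqP ->.
  by split=> // g p Ag; rewrite inE => /eqP ->; rewrite mulg1.
have [B fB RB] := RA A fA; have [C fC RC] := IH B fB; exists C => // f f01.
have [t tp [tC tf]] := RC f f01.
have h01 x : B x -> 0 <= integral t (fun y => f n (x * y)%g) <= 0 + 1.
  by move=> Bx; apply: integral_between => // p _; rewrite add0r.
have [s sp [sB [c sc]]] := RB _ 0 1 ler01 h01.
exists (product s t); first exact: prob_product.
split; first exact: product_sub sB tC.
move=> i; rewrite ltnS leq_eqVlt => /orP[/eqP ->|/tf[b tb]].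
  by exists c => g Ag; rewrite product_integral_translate -[e]mulr1; exact: sc.
exists b => g Ag; rewrite product_integral_translate.
by apply: integral_between => // p ps; apply: tb; exact: sB.
Qed.

(** * Approximately invariant measures and amenability *)

Lemma approximate_invariance :
  (forall A : set G, finite_set A ->
     exists2 B : set G, finite_set B & Ramsey_wrt (1 / 2 : R) B A) ->
  forall (l : seq (G * set G)) (e : R), 0 < e ->
  exists2 s : seq (R * G), prob s & forall p, p \in l ->
    `|integral s (ind (translate p.1 p.2)) - integral s (ind p.2)| <= e.
Proof.
move=> half l e e0; have [n ne] := expr_three_quarters_small e0.
have d0 : 0 <= 3 / 4 :> R by lra.
have RA : forall A, finite_set A ->
    exists2 B, finite_set B & Ramsey_function ((3 / 4) ^+ n) B A.
  apply: Ramsey_function_expr => // A /half[B fB RB].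
  by exists B => //; exact: Ramsey_function_of_half.
(* The identity stands for a set itself and the inverses for its translates, so both integrals fall
   into one interval of length (3/4)^n. *)
pose A : set G := [set` 1%g :: [seq p.1^-1%g | p <- l]].
have [B _ RB] := Ramsey_functions (exprn_ge0 n d0) RA (size l) (finite_seq _ : finite_set A).
have [|s sp [_ sl]] := RB (fun i => ind (nth (1%g, set0) l i).2).
  by move=> i x; rewrite ind_ge0 ind_le1.
exists s => // p pl; have [|c sc] := sl (index p l); first by rewrite index_mem.
have /sc : A (p.1)^-1%g by rewrite /A /= inE (map_f (fun p => p.1^-1%g)) ?orbT.
have /sc : A 1%g by rewrite /A /= inE eqxx.
rewrite nth_index//.
rewrite (_ : (fun x => ind p.2 (1 * x)%g) = ind p.2); last first.
  by apply/funext => x; rewrite mul1g.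
rewrite (_ : (fun x => ind p.2 (p.1^-1 * x)%g) = ind (translate p.1 p.2)); last first.
  by apply/funext => x; rewrite ind_translate.
by move=> /andP[? ?] /andP[? ?]; rewrite (le_trans _ ne)// ler_norml; lra.
Qed.

Lemma amenable_of_half_Ramsey :
  (forall A : set G, finite_set A ->
     exists2 B : set G, finite_set B & Ramsey_wrt (1 / 2 : R) B A) ->
  amenable R G.
Proof.
move=> half.
(* Each basic set asks for invariance up to an error on finitely many pairs; one ultrafilter then
   gives the limits at all sets simultaneously. *)
pose F := filter_from [set le : seq (G * set G) * R | 0 < le.2]
  (fun le => [set m : set G -> R | finitely_additive_probability m /\
     forall p, p \in le.1 -> `|m (translate p.1 p.2) - m p.2| <= le.2]).
have FF : ProperFilter F.
  apply: filter_from_proper.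
    apply: filter_from_filter; first by exists ([::], 1) => /=.
    move=> [l1 e1] [l2 e2] /= e1_gt0 e2_gt0.
    exists (l1 ++ l2, Num.min e1 e2); first by rewrite /= lt_min e1_gt0.
    move=> m /= [mp ml]; split; split=> // p pl; have := ml p;
      by rewrite mem_cat pl ?orbT le_min => /(_ isT)/andP[].
  move=> [l e] /= e0; have [s sp sl] := approximate_invariance half l e0.
  by exists (fun E => integral s (ind E)); split=> //; exact: fap_integral.
have [U [UU FU]] := ultraFilterLemma FF.
have Ufap : U [set m | finitely_additive_probability m].
  by apply: FU; exists ([::], 1) => //= m [].
have U01 E : U [set m | 0 <= m E <= 1].
  by apply: filterS Ufap => m /= mp; rewrite fap_le1// andbT; case: mp.
pose mu E := ultralimit U (fun m => m E).
have mu_near E e : 0 < e -> U [set m | `|m E - mu E| <= e] by exact: near_ultralimit.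
exists mu; first split; first split.
- move=> E; apply/ler_addgt0Pr => e e0.
  have [m [/andP[m0 _]]] := filter_ex (filterI (U01 E) (mu_near E e e0)).
  by rewrite /= ler_norml => /andP[]; lra.
- apply: ultralimit_unique => // e e0; apply: filterS Ufap => m /= [_ -> _].
  by rewrite subrr normr0 ltW.
- move=> E E' EE'; apply: ultralimit_unique => // e e0.
  (* Half of the error goes to each of the two limits being added. *)
  have e2 : 0 < e / 2 by rewrite divr_gt0.
  apply: filterS3 Ufap (mu_near E _ e2) (mu_near E' _ e2) => m [_ _ mD].
  rewrite /= mD// !ler_norml => /andP[? ?] /andP[? ?]; lra.
- by move=> E; rewrite setIT.
- move=> g E; apply: ultralimit_unique => // e e0.
  have e2 : 0 < e / 2 by rewrite divr_gt0.
  have Ug : U [set m | `|m (translate g E) - m E| <= e / 2].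
    apply: FU; exists ([:: (g, E)], e / 2) => //= m [_ /(_ (g, E))].
    by rewrite inE eqxx => /(_ isT).
  apply: filterS2 Ug (mu_near E _ e2) => m /=.
  rewrite !ler_norml => /andP[? ?] /andP[? ?]; lra.
Qed.

End Amenability.

Theorem theorem1p3 (R : realType) (G : groupType) :
  [<-> forall (E A : set G), finite_set A ->
         exists2 mu : set G -> R, fap_on setT mu &
           forall g : G, A g -> mu (translate g E) = mu E;
       forall A : set G, finite_set A ->
         exists2 B : set G, finite_set B & Ramsey_wrt (1 / 2 : R) B A;
       forall A : set G, finite_set A ->
         exists2 B : set G, finite_set B & Ramsey_wrt (0 : R) B A;
       amenable R G].
Proof.
have weaken : (forall A : set G, finite_set A ->
      exists2 B : set G, finite_set B & Ramsey_wrt (0 : R) B A) ->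
    forall A : set G, finite_set A ->
      exists2 B : set G, finite_set B & Ramsey_wrt (1 / 2 : R) B A.
  move=> zero A /zero[B fB RB]; exists B => // E /RB[nu nuB [AB nuE]].
  exists nu => //; split=> // mu mu' muA mu'A.
  by rewrite (le_trans (nuE _ _ muA mu'A))// divr_ge0.
have measures : amenable R G -> forall (E A : set G), finite_set A ->
    exists2 mu : set G -> R, fap_on setT mu &
      forall g : G, A g -> mu (translate g E) = mu E.
  by move=> [mu mup muG] E A _; exists mu => // g _; exact: muG.
tfae.
- by move=> /Ramsey0_of_invariant_measures/weaken.
(* The constant drops from 1/2 to 0 by a detour through amenability and condition (1). *)
- move=> /amenable_of_half_Ramsey/measures; exact: Ramsey0_of_invariant_measures.
- by move=> /weaken/amenable_of_half_Ramsey.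
- exact: measures.
Qed.
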